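(* Let $G \subseteq W = (\mathbb{Z}/2\mathbb{Z})^4 \rtimes S_5$ be an arbitrary subgroup. Then the $2$-torsion subgroup $H^1(G, \mathfrak{P})_2$ of $H^1(G,\mathfrak{P})$ is generated by $2$-torsion classes of types I and II.
   Context: $W = (\mathbb{Z}/2\mathbb{Z})^4 \rtimes S_5$, where $(\mathbb{Z}/2\mathbb{Z})^4$ denotes $\{(a_1,\ldots,a_5) \in (\mathbb{Z}/2\mathbb{Z})^5 \mid a_1+\cdots+a_5=0\}$, acted upon by $S_5$ by permuting coordinates. $P$ is the free abelian group on the symbols $[e_1],\ldots,[e_5]$, and $\mathfrak{P} \subset P\otimes_{\mathbb{Z}}\mathbb{Q}$ is the subgroup generated by $P$ and the element $\frac12([e_1]+\cdots+[e_5])$. The group $W$ acts on $\mathfrak{P}$: $S_5$ permutes the indices and $(a_1,\ldots,a_5)$ sends $[e_i]$ to $(-1)^{a_i}[e_i]$. Let $p\colon W \to S_5$ be the natural projection and put $S := p(G) \subseteq S_5$, acting on $\{1,\ldots,5\}$. $\iota_{\mathrm{Pic}}$ denotes the connecting homomorphism $(\mathfrak{P}/2\mathfrak{P})^G \to H^1(G,\mathfrak{P})_2$ associated with $0\to\mathfrak{P}\xrightarrow{\cdot 2}\mathfrak{P}\to\mathfrak{P}/2\mathfrak{P}\to 0$; that is, $\iota_{\mathrm{Pic}}(\overline{c})$ is the class of the $1$-cocycle $\sigma\mapsto\frac12(\sigma(c)-c)$. Bars denote residue classes modulo $2\mathfrak{P}$. A nonzero element $\alpha\in H^1(G,\mathfrak{P})_2$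 is a $2$-torsion class of type I if $\alpha=\iota_{\mathrm{Pic}}(\overline{[e_i]})$ for some $i\in\{1,\ldots,5\}$ such that $\{i\}$ is an $S$-orbit. It is a $2$-torsion class of type II if $\alpha=\iota_{\mathrm{Pic}}(\overline{[e_i]+[e_j]})$ for some $S$-orbit $\{i,j\}\subset\{1,\ldots,5\}$ of length two. *)

(* Defs.v *)
From HB Require Import structures.
From mathcomp Require Import all_boot all_order all_fingroup all_algebra.
From mathcomp Require Import generic_quotient ring_quotient.
From mathcomp Require Import boolp classical_sets.

Set Implicit Arguments.
Unset Strict Implicit.
Unset Printing Implicit Defensive.

Import GroupScope GRing.Theory Num.Theory.
Local Open Scope ring_scope.
Local Open Scope quotient_scope.

Definition gen_zmod (V : zmodType) (X : set V) : set V :=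
  smallest (fun A : set V => zmod_closed (fun v => v \in A)) X.

Lemma gen_zmod_closed (V : zmodType) (X : set V) :
  zmod_closed (fun v => v \in gen_zmod X).
Proof.
split=> [|x y]; rewrite /in_mem /= -!/(_ \in _).
  by rewrite in_setE => A [[A0 _] _]; rewrite -in_setE; apply: A0.
rewrite !in_setE => Gx Gy A [A_zmod XA].
have [_ AB] := A_zmod; rewrite -in_setE; apply: AB.
  by rewrite /in_mem /= -/(_ \in _) in_setE; apply: Gx.
by rewrite /in_mem /= -/(_ \in _) in_setE; apply: Gy.
Qed.

(* The pair (a, s) is the signed permutation a \o s, that is, first s then a.  *)
(* Products in W are composites of maps, (g * h) = g \o h, so that W acts on   *)
(* the left. The product of 'S_5 in perm.v is the opposite one, (s * t) i =    *)
(* t (s i), whence the t * s in W_mul.                                         *)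
Record W := SignedPerm {
  W_val : 'rV['Z_2]_5 * 'S_5;
  _ : \sum_i W_val.1 0 i == 0 }.

HB.instance Definition _ := [isSub for W_val].
HB.instance Definition _ := [Finite of W by <:].

Definition W_sign (g : W) : 'rV['Z_2]_5 := (W_val g).1.
Definition W_perm (g : W) : 'S_5 := (W_val g).2.

Lemma sum_W_sign g : \sum_i W_sign g 0 i = 0.
Proof. by apply/eqP; apply: (valP g). Qed.

(* S_5 permutes coordinates: s sends the i-th basis vector to the s(i)-th.     *)
Definition permute_coord (R : Type) (s : 'S_5) (x : 'rV[R]_5) : 'rV[R]_5 :=
  \row_j x 0 ((s^-1)%g j).

Lemma sum_permute_coord (s : 'S_5) (x : 'rV['Z_2]_5) :
  \sum_i permute_coord s x 0 i = \sum_i x 0 i.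
Proof.
under eq_bigr do rewrite mxE.
by rewrite [RHS](reindex_inj (perm_inj (s := (s^-1)%g))).
Qed.

Lemma W_one_subproof : \sum_i ((0 : 'rV['Z_2]_5), (1%g : 'S_5)).1 0 i == 0.
Proof. by rewrite /= big1 // => i _; rewrite mxE. Qed.
Definition W_one : W := SignedPerm W_one_subproof.

Lemma W_mul_subproof (g h : W) :
  \sum_i (W_sign g + permute_coord (W_perm g) (W_sign h),
          (W_perm h * W_perm g)%g).1 0 i == 0.
Proof.
rewrite /=; under eq_bigr do rewrite mxE.
by rewrite big_split /= sum_permute_coord !sum_W_sign addr0.
Qed.
Definition W_mul (g h : W) : W := SignedPerm (W_mul_subproof g h).

Lemma W_inv_subproof (g : W) :
  \sum_i (- permute_coord (W_perm g)^-1%g (W_sign g),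
          (W_perm g)^-1%g).1 0 i == 0.
Proof.
rewrite /=; under eq_bigr do rewrite mxE.
by rewrite sumrN sum_permute_coord sum_W_sign oppr0.
Qed.
Definition W_inv (g : W) : W := SignedPerm (W_inv_subproof g).

Lemma W_mulA : associative W_mul.
Proof.
move=> g h k; apply: val_inj => /=; congr pair; last by rewrite /W_perm /= mulgA.
by apply/rowP=> j; rewrite !mxE addrA /W_perm /= invMg permM.
Qed.

Lemma W_mul1 : left_id W_one W_mul.
Proof.
move=> [[a s] g0]; apply: val_inj => /=; rewrite /W_perm /= mulg1; congr pair.
by apply/rowP=> j; rewrite !mxE add0r invg1 perm1.
Qed.

Lemma W_mulV : left_inverse W_one W_inv W_mul.
Proof.
move=> g; apply: val_inj => /=; rewrite /W_perm /= mulgV; congr pair.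
by apply/rowP=> j; rewrite !mxE addNr.
Qed.

HB.instance Definition _ := Finite_isGroup.Build W W_mulA W_mul1 W_mulV.

(* p(G) for the projection p : W -> S_5.                                       *)
Definition perm_image (G : {group W}) : {set 'S_5} := W_perm @: G.

(* P is Z^5 and its tensor product with Q is Q^5, with standard basis [e_i].   *)
Definition e_rat (i : 'I_5) : 'rV[rat]_5 := delta_mx 0 i.

Definition P_lattice : set 'rV[rat]_5 :=
  range (map_mx intr : 'rV[int]_5 -> 'rV[rat]_5).

Definition half_sum : 'rV[rat]_5 := 2^-1 *: \sum_i e_rat i.

Definition frakP_lattice : {pred 'rV[rat]_5} :=
  fun v => v \in gen_zmod (P_lattice `|` [set half_sum])%classic.

HB.instance Definition _ :=
  GRing.isZmodClosed.Build _ frakP_lattice (gen_zmod_closed _).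

Record frakP := FrakP {
  frakP_val :> 'rV[rat]_5;
  _ : frakP_val \in frakP_lattice }.

HB.instance Definition _ := [isSub for frakP_val].
HB.instance Definition _ := [Choice of frakP by <:].
HB.instance Definition _ := [SubChoice_isSubZmodule of frakP by <:].

Definition W_act_rat (g : W) (x : 'rV[rat]_5) : 'rV[rat]_5 :=
  \row_j ((-1) ^+ W_sign g 0 j * permute_coord (W_perm g) x 0 j).

Lemma W_act_rat_e_rat g i :
  W_act_rat g (e_rat i) = (-1) ^+ W_sign g 0 (W_perm g i) *: e_rat (W_perm g i).
Proof.
apply/rowP=> j; rewrite !mxE /=.
by case: (j =P W_perm g i) => [->|/eqP nj]; rewrite ?permK ?eqxx //;
  rewrite (canF_eq (permKV _)) (negPf nj) !mulr0.
Qed.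

Lemma W_act_rat_zmod_morphism g : zmod_morphism (W_act_rat g).
Proof. by move=> x y; apply/rowP=> j; rewrite !mxE -mulrBr. Qed.

HB.instance Definition _ g :=
  GRing.isZmodMorphism.Build _ _ (W_act_rat g) (W_act_rat_zmod_morphism g).

Lemma W_act_rat1 x : W_act_rat 1%g x = x.
Proof. by apply/rowP=> j; rewrite !mxE expr0 mul1r invg1 perm1. Qed.

Lemma signr_Z2D (a b : 'Z_2) : (-1) ^+ (a + b)%R = (-1) ^+ a * (-1) ^+ b :> rat.
Proof.
by case: a b => -[|[|//]] ? [[|[|//]] ?]; rewrite /= ?expr0 ?expr1 ?mul1r ?mulr1 ?mulrNN.
Qed.

Lemma W_act_ratM (g h : W) x : W_act_rat (g * h)%g x = W_act_rat g (W_act_rat h x).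
Proof.
apply/rowP=> j; rewrite !mxE mulrA; congr (_ * x 0 _).
  by rewrite -signr_Z2D.
by rewrite [W_perm (g * h)%g]/W_perm /= invMg permM.
Qed.

Lemma half_sumE j : half_sum 0 j = 2^-1.
Proof.
rewrite mxE summxE (bigD1 j) //= big1 => [|i ij]; first by rewrite mxE !eqxx mulr1.
by rewrite mxE eqxx eq_sym (negPf ij).
Qed.

Lemma mem_P_lattice v : P_lattice v -> v \in frakP_lattice.
Proof. by move=> Pv; rewrite inE => A [_ sXA]; apply: sXA; left. Qed.

Lemma mem_half_sum : half_sum \in frakP_lattice.
Proof. by rewrite inE => A [_ sXA]; apply: sXA; right. Qed.

Lemma W_act_rat_frakP g v :
  v \in frakP_lattice -> W_act_rat g v \in frakP_lattice.
Proof.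
move=> /asboolP/(_ [set x | W_act_rat g x \in frakP_lattice]%classic).
apply; split.
  split=> [|x y]; rewrite -!topredE /= !inE /= ?raddf0 ?rpred0 //.
  by move=> xP yP; rewrite raddfB rpredB.
move=> _ [[x _ <-]|->] /=.
  apply: mem_P_lattice.
  exists (\row_j ((-1) ^+ W_sign g 0 j * permute_coord (W_perm g) x 0 j)) => //.
  by apply/rowP=> j; rewrite !mxE rmorphM rmorph_sign.
rewrite -[W_act_rat g _](subrK half_sum) rpredD ?mem_half_sum //.
apply: mem_P_lattice; exists (\row_j - (W_sign g 0 j)%:R) => //.
apply/rowP=> j; move: half_sum half_sumE => h hE; rewrite !mxE !hE.
by case: (W_sign g 0 j) => -[|[|//]] ? /=; rewrite ?expr0 ?expr1.
Qed.

Definition W_act (g : W) (x : frakP) : frakP :=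
  FrakP (W_act_rat_frakP g (valP x)).

Lemma W_act_zmod_morphism g : zmod_morphism (W_act g).
Proof. by move=> x y; apply: val_inj; rewrite /= raddfB. Qed.

HB.instance Definition _ g :=
  GRing.isZmodMorphism.Build _ _ (W_act g) (W_act_zmod_morphism g).

Lemma W_act1 x : W_act 1%g x = x.
Proof. by apply: val_inj; rewrite /= W_act_rat1. Qed.

Lemma W_actM (g h : W) x : W_act (g * h)%g x = W_act g (W_act h x).
Proof. by apply: val_inj; rewrite /= W_act_ratM. Qed.

Lemma e_frakP i : e_rat i \in frakP_lattice.
Proof. by apply: mem_P_lattice; exists (delta_mx 0 i); rewrite ?map_delta_mx. Qed.

(* The generator [e_i], as an element of frakP.                                *)
Definition e (i : 'I_5) : frakP := FrakP (e_frakP i).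

Definition two_frakP : {pred frakP} :=
  fun x => x \in range (fun y : frakP => y *+ 2).

Lemma two_frakPP x : reflect (exists y, x = y *+ 2) (x \in two_frakP).
Proof.
apply: (iffP idP); first by rewrite inE => -[y _ <-]; exists y.
by case=> y ->; rewrite inE; exists y.
Qed.

Lemma two_frakP_zmod_closed : zmod_closed two_frakP.
Proof.
split=> [|_ _ /two_frakPP[x ->] /two_frakPP[y ->]]; apply/two_frakPP.
  by exists 0; rewrite mul0rn.
by exists (x - y); rewrite mulrnBl.
Qed.

HB.instance Definition _ :=
  GRing.isZmodClosed.Build _ two_frakP two_frakP_zmod_closed.

Definition frakP_mod2 : zmodType := Quotient.quot two_frakP.

Definition bar (x : frakP) : frakP_mod2 := \pi_(Quotient.quot two_frakP) x.

HB.instance Definition _ := GRing.isZmodMorphism.Build _ _ bar (raddfB _).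

Lemma bar_repr (x : frakP_mod2) : bar (repr x) = x.
Proof. exact: reprK. Qed.

Definition W_act_mod2 (g : W) (x : frakP_mod2) : frakP_mod2 :=
  bar (W_act g (repr x)).

Lemma bar_eqP x y : reflect (bar x = bar y) (x - y \in two_frakP).
Proof. by rewrite Quotient.idealrBE; apply: eqP. Qed.

Lemma W_act_mod2_bar g x : W_act_mod2 g (bar x) = bar (W_act g x).
Proof.
apply/bar_eqP; rewrite -raddfB.
have /bar_eqP/two_frakPP[y ->] : bar (repr (bar x)) = bar x by rewrite bar_repr.
by apply/two_frakPP; exists (W_act g y); rewrite raddfMn.
Qed.

Lemma W_act_mod2_zmod_morphism g : zmod_morphism (W_act_mod2 g).
Proof.
move=> x y; rewrite -[x]bar_repr -[y]bar_repr -raddfB.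
by rewrite !W_act_mod2_bar !raddfB.
Qed.

HB.instance Definition _ g :=
  GRing.isZmodMorphism.Build _ _ (W_act_mod2 g) (W_act_mod2_zmod_morphism g).

Definition is_invariant (G : {group W}) : {pred frakP_mod2} :=
  fun x => [forall g in G, W_act_mod2 g x == x].

Arguments is_invariant : clear implicits.

Lemma is_invariant_zmod_closed (G : {group W}) : zmod_closed (is_invariant G).
Proof.
split=> [|x y /'forall_in_eqP xP /'forall_in_eqP yP].
  by apply/'forall_in_eqP=> g _; rewrite raddf0.
by apply/'forall_in_eqP=> g Gg; rewrite raddfB /= xP ?yP.
Qed.

HB.instance Definition _ (G : {group W}) :=
  GRing.isZmodClosed.Build _ (is_invariant G) (is_invariant_zmod_closed G).

Record mod2_invariants (G : {group W}) := Mod2Invariant {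
  invariant_val :> frakP_mod2;
  _ : invariant_val \in is_invariant G }.

HB.instance Definition _ (G : {group W}) := [isSub for @invariant_val G].
HB.instance Definition _ (G : {group W}) := [Choice of mod2_invariants G by <:].
HB.instance Definition _ (G : {group W}) :=
  [SubChoice_isSubZmodule of mod2_invariants G by <:].

Definition is_cocycle (G : {group W}) : {pred {ffun subg_of G -> frakP}} :=
  fun f => [forall g, forall h, f (g * h)%g == f g + W_act (sgval g) (f h)].

Arguments is_cocycle : clear implicits.

Lemma is_cocycleP (G : {group W}) (f : {ffun subg_of G -> frakP}) :
  reflect (forall g h, f (g * h)%g = f g + W_act (sgval g) (f h))
          (f \in is_cocycle G).
Proof. exact: 'forall_'forall_eqP. Qed.

Lemma is_cocycle_zmod_closed (G : {group W}) : zmod_closed (is_cocycle G).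
Proof.
split=> [|f1 f2 /is_cocycleP f1P /is_cocycleP f2P]; apply/is_cocycleP=> g h.
  by rewrite !ffunE raddf0 addr0.
by rewrite !ffunE f1P f2P raddfB opprD addrACA.
Qed.

HB.instance Definition _ (G : {group W}) :=
  GRing.isZmodClosed.Build _ (is_cocycle G) (is_cocycle_zmod_closed G).

Record Z1 (G : {group W}) := Cocycle {
  cocycle_val :> {ffun subg_of G -> frakP};
  _ : cocycle_val \in is_cocycle G }.

HB.instance Definition _ (G : {group W}) := [isSub for @cocycle_val G].
HB.instance Definition _ (G : {group W}) := [Choice of Z1 G by <:].
HB.instance Definition _ (G : {group W}) := [SubChoice_isSubZmodule of Z1 G by <:].

Definition is_coboundary (G : {group W}) : {pred Z1 G} :=
  fun f => `[< exists m : frakP, forall g, f g = W_act (sgval g) m - m >].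

Arguments is_coboundary : clear implicits.

Lemma is_coboundary_zmod_closed (G : {group W}) :
  zmod_closed (is_coboundary G).
Proof.
split=> [|f1 f2 /asboolP[m1 f1P] /asboolP[m2 f2P]]; apply/asboolP.
  by exists 0 => g; rewrite raddf0 subr0 ffunE.
exists (m1 - m2) => g; rewrite [cocycle_val _](raddfB val) /=.
by rewrite !ffunE f1P f2P [W_act _ (m1 - m2)]raddfB !opprD addrACA.
Qed.

HB.instance Definition _ (G : {group W}) :=
  GRing.isZmodClosed.Build _ (is_coboundary G) (is_coboundary_zmod_closed G).

Definition H1 (G : {group W}) : zmodType := Quotient.quot (is_coboundary G).

Definition H1_class (G : {group W}) (f : Z1 G) : H1 G :=
  \pi_(Quotient.quot (is_coboundary G)) f.

HB.instance Definition _ (G : {group W}) :=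
  GRing.isZmodMorphism.Build _ _ (@H1_class G) (raddfB _).

Definition H1_tors2 (G : {group W}) : set (H1 G) :=
  [set alpha | alpha *+ 2 = 0]%classic.

Arguments H1_tors2 : clear implicits.

Lemma half_frakP (x : frakP) :
  x \in two_frakP -> 2^-1 *: frakP_val x \in frakP_lattice.
Proof.
case/two_frakPP=> y ->; rewrite [frakP_val _](raddfMn val) -scaler_nat.
by rewrite scalerA mulVf // scale1r (valP y).
Qed.

Section Connecting.

Variables (G : {group W}) (c : frakP).
Hypothesis c_inv : forall g : subg_of G, W_act (sgval g) c - c \in two_frakP.

Definition half_cochain : {ffun subg_of G -> frakP} :=
  [ffun g => FrakP (half_frakP (c_inv g))].

Lemma half_cochain_is_cocycle : half_cochain \in is_cocycle G.
Proof.
apply/is_cocycleP=> g h; rewrite !ffunE; apply: val_inj => /=.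
have actZ (a : rat) u : W_act_rat (sgval g) (a *: u) = a *: W_act_rat (sgval g) u.
  by apply/rowP=> j; rewrite !mxE mulrCA.
rewrite W_act_ratM actZ -scalerDr [W_act_rat _ (_ - _)]raddfB /=.
by rewrite [X in _ = _ *: X]addrC subrKA.
Qed.

Definition half_cocycle : Z1 G := Cocycle half_cochain_is_cocycle.

End Connecting.

Lemma invariant_repr (G : {group W}) (x : mod2_invariants G) (c : frakP) :
  invariant_val x = bar c ->
  forall g : subg_of G, W_act (sgval g) c - c \in two_frakP.
Proof.
move=> xc g; apply/bar_eqP; rewrite -W_act_mod2_bar -xc.
by apply: ('forall_in_eqP (valP x)); apply: subgP.
Qed.

(* The lift of x chosen here is irrelevant, see iota_PicE.                     *)
Definition iota_Pic (G : {group W}) (x : mod2_invariants G) : H1 G :=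
  H1_class (half_cocycle (invariant_repr (esym (bar_repr (invariant_val x))))).

Lemma iota_PicE (G : {group W}) (x : mod2_invariants G) (c : frakP)
    (xc : invariant_val x = bar c) :
  iota_Pic x = H1_class (half_cocycle (invariant_repr xc)).
Proof.
apply/eqP; rewrite -Quotient.idealrBE.
have /bar_eqP/two_frakPP[y def_y] : bar (repr (invariant_val x)) = bar c.
  by rewrite bar_repr.
apply/asboolP; exists y => g; rewrite [cocycle_val _](raddfB val) /= !ffunE.
apply: val_inj => /=.
have key : W_act (sgval g) (repr (invariant_val x)) - repr (invariant_val x)
    - (W_act (sgval g) c - c) = (W_act (sgval g) y - y) *+ 2.
  rewrite mulrnBl -raddfMn -def_y (raddfB (W_act (sgval g))) /=.
  by rewrite !opprD !opprK addrACA.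
move/(congr1 val): key; rewrite !(raddfB val) (raddfMn val) !(raddfB val) /=.
by rewrite -scalerBr => ->; rewrite -scaler_nat scalerA mulVf // scale1r.
Qed.

Lemma iota_Pic_zmod_morphism (G : {group W}) : zmod_morphism (@iota_Pic G).
Proof.
move=> x y; have xyc : invariant_val (x - y) =
    bar (repr (invariant_val x) - repr (invariant_val y)).
  by rewrite [LHS](raddfB val) /= (raddfB bar) /= !bar_repr.
rewrite (iota_PicE xyc) /iota_Pic -raddfB; congr (H1_class _).
apply: val_inj; rewrite [RHS](raddfB val) /=; apply/ffunP=> g.
rewrite !ffunE; apply: val_inj => /=.
by rewrite -scalerBr (raddfB (W_act_rat (sgval g))) /= !opprD !opprK addrACA.
Qed.

HB.instance Definition _ (G : {group W}) :=
  GRing.isZmodMorphism.Build _ _ (@iota_Pic G) (@iota_Pic_zmod_morphism G).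

(* The orbit hypotheses make the classes of [e_i] and [e_i] + [e_j] invariant, *)
(* see e_invariant and eD_invariant; the variable x is that class seen as an   *)
(* element of (frakP / 2 frakP)^G, the domain of iota_Pic.                     *)

Definition type_I (G : {group W}) : set (H1 G) := fun alpha =>
  [/\ alpha \in H1_tors2 G, alpha != 0 &
   exists (i : 'I_5) (x : mod2_invariants G),
     [/\ orbit 'P (perm_image G) i = [set i]%SET,
         invariant_val x = bar (e i) & alpha = iota_Pic x]].

Definition type_II (G : {group W}) : set (H1 G) := fun alpha =>
  [/\ alpha \in H1_tors2 G, alpha != 0 &
   exists (i j : 'I_5) (x : mod2_invariants G),
     [/\ i != j, orbit 'P (perm_image G) i = [set i; j]%SET,
         invariant_val x = bar (e i + e j) & alpha = iota_Pic x]].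

Arguments type_I : clear implicits.
Arguments type_II : clear implicits.

Lemma W_act_mod2_e g i : W_act_mod2 g (bar (e i)) = bar (e (W_perm g i)).
Proof.
rewrite W_act_mod2_bar; apply/bar_eqP/two_frakPP.
exists (- e (W_perm g i) *+ W_sign g 0 (W_perm g i)).
apply: val_inj; rewrite (raddfB val) !(raddfMn val) (raddfN val) /= W_act_rat_e_rat.
case: (W_sign g 0 _) => -[|[|//]] ? /=; rewrite ?expr0 ?expr1 ?scale1r ?subrr ?mul0rn //.
by rewrite scaleN1r -opprD mulr1n mulr2n opprD.
Qed.

Lemma e_invariant (G : {group W}) i :
  orbit 'P (perm_image G) i = [set i]%SET -> bar (e i) \in is_invariant G.
Proof.
move=> orb; apply/'forall_in_eqP=> g Gg; rewrite W_act_mod2_e.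
suff /set1P-> : W_perm g i \in [set i]%SET by [].
by rewrite -orb; apply: mem_orbit; apply: imset_f.
Qed.

Lemma eD_invariant (G : {group W}) i j :
    i != j -> orbit 'P (perm_image G) i = [set i; j]%SET ->
  bar (e i + e j) \in is_invariant G.
Proof.
move=> ij orb; apply/'forall_in_eqP=> g Gg.
rewrite (raddfD bar) (raddfD (W_act_mod2 g)) /= !W_act_mod2_e.
have orbW k h : h \in G -> k \in [set i; j]%SET -> W_perm h k \in [set i; j]%SET.
  move=> Gh; rewrite -orb => /imsetP[_ /imsetP[k' Gk' ->] ->].
  apply/imsetP; exists (W_perm (h * k')%g); last by rewrite /= /aperm permM.
  by apply: imset_f; rewrite groupM.
have := orbW i g Gg; have := orbW j g Gg; rewrite !inE !eqxx orbT.
have := inj_eq (@perm_inj _ (W_perm g)) i j; rewrite (negPf ij).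
move=> nW /(_ isT) /orP[] /eqP Wj /(_ isT) /orP[] /eqP Wi;
  by move: nW; rewrite Wi Wj ?eqxx // addrC.
Qed.

(* Main.v *)
(** By the long exact sequence, a 2-torsion class is [iota_Pic] of an invariant
    class modulo [2 frakP]. Such a class is represented either by the sum of the
    [e_i] over a set [A], which may be replaced by its complement because
    [e_1 + ... + e_5] lies in [2 frakP], or by a vector [u] with all entries
    [1/2] or [-1/2]. In the first case we may take [#|A| <= 2]; then S
    preserves [A], as it cannot map [A] to its larger complement, and [iota_Pic]
    is a sum of classes of types I and II. In the second case each g in G
    maps [u] to [u] or [- u]; as W changes an even number of signs and 5 is odd,
    [g u = u], whence [iota_Pic] vanishes. *)

Require Import Defs.
From mathcomp Require Import all_boot all_order all_fingroup all_algebra.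
From mathcomp Require Import generic_quotient ring_quotient zify ring lra.
From mathcomp Require Import boolp classical_sets.

Set Implicit Arguments.
Unset Strict Implicit.
Unset Printing Implicit Defensive.

Import GRing.Theory.
Local Open Scope ring_scope.

(** * Coordinates in [frakP] and congruence modulo [2 frakP] *)

Lemma frakP_valD (x y : frakP) i :
  frakP_val (x + y) 0 i = frakP_val x 0 i + frakP_val y 0 i.
Proof. by rewrite [frakP_val _](raddfD val) mxE. Qed.

Lemma frakP_valMn (x : frakP) n i :
  frakP_val (x *+ n) 0 i = frakP_val x 0 i *+ n.
Proof. by rewrite [frakP_val _](raddfMn val) mulmxnE. Qed.

(** The union of Z^5 and Z^5 + [half_sum] is a subgroup containing the generators, so it contains
    [frakP] by minimality. *)
Lemma frakP_intP (v : frakP) :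
  exists (z : 'rV[int]_5) (b : bool),
    forall i, frakP_val v 0 i = (z 0 i)%:~R + b%:R / 2.
Proof.
have /asboolP/(_ [set v | exists (z : 'rV[int]_5) (b : bool),
    forall i, v 0 i = (z 0 i)%:~R + b%:R / 2]%classic) := valP v.
apply; split.
  split=> [|x y]; rewrite -!topredE /= !inE /=.
    by exists 0, false => i; rewrite !mxE mul0r addr0.
  move=> [z [b zE]] [z' [b' z'E]].
  (* The term [~~ b && b'] is the borrow: 0 - 1/2 = -1 + 1/2. *)
  exists (\row_i (z 0 i - z' 0 i - (~~ b && b')%:R)), (b (+) b') => i.
  rewrite !mxE zE z'E !intrD !mulrNz.
  by case: b {zE}; case: b' {z'E} => /=; rewrite ?mulr1n ?mulr0n; field.
move=> _ [[x _ <-]|->] /=.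
  by exists x, false => i; rewrite mxE mul0r addr0.
by exists 0, true => i; rewrite half_sumE mxE add0r mul1r.
Qed.

Lemma frakP_of_int (z : 'rV[int]_5) (b : bool) :
  exists v : frakP, forall i, frakP_val v 0 i = (z 0 i)%:~R + b%:R / 2.
Proof.
have zP : map_mx intr z \in frakP_lattice by apply: mem_P_lattice; exists z.
exists (FrakP zP + FrakP mem_half_sum *+ b) => i.
rewrite frakP_valD frakP_valMn half_sumE mxE.
by case: b; rewrite /= ?mulr1n ?mulr0n ; field.
Qed.

(** The difference is twice an element z + b/2 of [frakP]. Thus integral vectors are compared by the
    parities of their entries, up to flipping all five at once. *)
Lemma bar_eq_parityP (x y : frakP) :
  bar x = bar y <->
  exists (z : 'rV[int]_5) (b : bool),
    forall i, frakP_val x 0 i = frakP_val y 0 i + (z 0 i)%:~R * 2 + b%:R.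
Proof.
split=> [/bar_eqP/two_frakPP[w xyw]|[z [b xyE]]].
  have [z [b wE]] := frakP_intP w; exists z, b => i.
  have -> : x = y + w *+ 2 by rewrite -xyw addrC subrK.
  by rewrite frakP_valD frakP_valMn wE; field.
have [w wE] := frakP_of_int z b.
apply/bar_eqP/two_frakPP; exists w; apply: (canLR (addrK _)).
by apply: val_inj; apply/rowP=> i; rewrite frakP_valD frakP_valMn wE xyE; field.
Qed.

(** * Representatives of the classes modulo [2 frakP] *)

Definition e_sum (A : {set 'I_5}) : frakP := \sum_(i in A) e i.

Lemma e_sumE A i : frakP_val (e_sum A) 0 i = (i \in A)%:R.
Proof.
rewrite [frakP_val _](raddf_sum val) summxE /=.
have [iA|niA] := boolP (i \in A).
  rewrite (bigD1 i) //= big1 => [|j /andP[_ ji]]; rewrite !mxE !eqxx ?addr0 //.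
  by rewrite eq_sym (negPf ji).
rewrite big1 // => j jA; rewrite mxE eqxx; case: eqP => //= ij.
by rewrite ij jA in niA.
Qed.

Lemma bar_e_sumC A : bar (e_sum (~: A)) = bar (e_sum A).
Proof.
apply/bar_eq_parityP.
exists (\row_i - (i \in A)%:R), true => i; rewrite !e_sumE inE mxE.
by case: (i \in A); rewrite /= ?mulr1n ?mulr0n ?rmorphN /=; ring.
Qed.

(** Equal classes force A to be B or its complement; the latter would give 5 = 2 #|B|. *)
Lemma bar_e_sum_inj (A B : {set 'I_5}) :
  #|A| = #|B| -> bar (e_sum A) = bar (e_sum B) -> A = B.
Proof.
move=> cAB /bar_eq_parityP[z [b zE]].
have AB i : (i \in A) = (i \in B) (+) b.
  have : z 0 i * 2 + (i \in B)%:R + b%:R = (i \in A)%:R.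
    apply: (@intr_inj rat); rewrite !(intrD, intrM) /= !mulrz_nat.
    by have := zE i; rewrite !e_sumE => ->; ring.
  by case: (i \in A); case: (i \in B); case: b {zE} => //=; lia.
case: b {zE} AB => AB; last by apply/setP=> i; rewrite AB addbF.
have AE : A = ~: B by apply/setP=> i; rewrite AB inE addbT.
have := cardsC B; rewrite -AE cAB card_ord addnn => /(congr1 odd).
by rewrite odd_double.
Qed.

Lemma W_act_mod2_e_sum g A :
  W_act_mod2 g (bar (e_sum A)) = bar (e_sum (W_perm g @: A)).
Proof.
rewrite (raddf_sum bar) (raddf_sum (W_act_mod2 g)) /= /e_sum.
rewrite big_imset ?(raddf_sum bar) /=; last by move=> i j _ _; apply: perm_inj.
by apply: eq_bigr => i _; rewrite W_act_mod2_e.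
Qed.

Lemma bar_cases (m : frakP) :
  (exists2 A : {set 'I_5}, #|A| <= 2 & bar m = bar (e_sum A))%N \/
  (exists2 u : frakP, forall i, frakP_val u 0 i ^+ 2 = 4^-1 & bar m = bar u).
Proof.
have [z [[|] zE]] := frakP_intP m; [right|left].
  (* The entry z_i + 1/2 is reduced modulo 2 to 1/2 for z_i even and to -1/2 for z_i odd. *)
  have [u uE] := frakP_of_int (\row_i - (odd (absz (z 0 i)))%:R) true.
  exists u => [i|].
    by rewrite uE mxE; case: odd; rewrite ?mulr1n ?mulr0n ?rmorphN /=; field.
  apply/bar_eq_parityP.
  exists (\row_i divz (z 0 i + (odd (absz (z 0 i)))%:R) 2), false => i.
  rewrite zE uE !mxE.
  have : z 0 i = divz (z 0 i + (odd (absz (z 0 i)))%:R) 2 * 2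
                 - (odd (absz (z 0 i)))%:R by lia.
  move: (odd _) (_ %/ _)%Z => o q ->.
  by rewrite !(intrD, intrM, rmorphN) /= !mulrz_nat; field.
have barA : bar m = bar (e_sum [set i | odd (absz (z 0 i))]).
  apply/bar_eq_parityP.
  exists (\row_i divz (z 0 i - (odd (absz (z 0 i)))%:R) 2), false => i.
  rewrite zE e_sumE inE !mxE.
  have : z 0 i = divz (z 0 i - (odd (absz (z 0 i)))%:R) 2 * 2
                 + (odd (absz (z 0 i)))%:R by lia.
  move: (odd _) (_ %/ _)%Z => o q ->.
  by rewrite !(intrD, intrM, rmorphN) /= !mulrz_nat; field.
move: barA; set A := [set i | _]%SET => barA.
have [leA|gtA] := leqP #|A| 2; first by exists A.
exists (~: A); last by rewrite bar_e_sumC.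
by rewrite -(leq_add2l #|A|) cardsC card_ord (leq_add gtA (leqnn 2)).
Qed.

(** * Vectors with all entries 1/2 or -1/2 *)

Lemma prod_sign_Z2 (a : 'rV['Z_2]_5) :
  \prod_i (-1) ^+ a 0 i = (-1) ^+ (\sum_i a 0 i)%R :> rat.
Proof.
exact/esym/(big_morph (fun b : 'Z_2 => (-1) ^+ b : rat) signr_Z2D).
Qed.

(** The signs of g multiply to 1 because [W_sign g] sums to 0. *)
Lemma prod_W_act g x :
  \prod_i frakP_val (W_act g x) 0 i = \prod_i frakP_val x 0 i.
Proof.
under eq_bigr do rewrite !mxE.
rewrite big_split /= prod_sign_Z2 sum_W_sign mul1r.
by rewrite [RHS](reindex_inj (perm_inj (s := ((W_perm g)^-1)%g))).
Qed.

Lemma W_act_sqr g x (a : rat) :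
  (forall i, frakP_val x 0 i ^+ 2 = a) ->
  forall i, frakP_val (W_act g x) 0 i ^+ 2 = a.
Proof. by move=> xE i; rewrite !mxE exprMn xE sqrr_sign mul1r. Qed.

Lemma W_act_fix_half_signs g (u : frakP) :
  (forall i, frakP_val u 0 i ^+ 2 = 4^-1) -> bar (W_act g u) = bar u ->
  W_act g u = u.
Proof.
move=> uE /bar_eq_parityP[z [b zE]].
have guE := W_act_sqr g uE.
have halfE (w : rat) : w ^+ 2 = 4^-1 -> exists s : bool, w = 2^-1 - s%:R.
  move=> wE; have /eqP : w ^+ 2 = 2^-1 ^+ 2 by rewrite wE; field.
  by rewrite eqf_sqr => /orP[] /eqP->; [exists false|exists true] => /=; field.
(* Corresponding entries 1/2 - s and 1/2 - t differ by t - s, whose parity is b, the same for every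
   coordinate. So either all signs agree or all are opposite. *)
have gu i : frakP_val (W_act g u) 0 i = (-1) ^+ b * frakP_val u 0 i.
  move: (zE i) (guE i) (uE i); move: (frakP_val (W_act g u) 0 i) => p.
  move: (frakP_val u 0 i) => q pq /halfE[s pE] /halfE[t qE].
  have : z 0 i * 2 + b%:R = t%:R - s%:R.
    apply: (@intr_inj rat); rewrite !(intrD, intrM, rmorphN) /= !mulrz_nat.
    by move: pq; rewrite pE qE => pq; lra.
  rewrite pE qE; case: s {pE}; case: t {qE}; case: b {zE pq} => //=;
    by [lia | rewrite ?expr1 => _; field].
case: b {zE} gu => gu; last first.
  by apply: val_inj; apply/rowP=> i; rewrite gu mul1r.
(* If g u = - u, the product p of the five entries satisfies p = - p, although p is nonzero. *)
have := prod_W_act g u; under eq_bigr do rewrite gu.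
rewrite big_split /= prodr_const card_ord.
have : \prod_i frakP_val u 0 i != 0.
  apply/prodf_neq0 => i _; apply/eqP=> ui0.
  by have := uE i; rewrite ui0 expr2 mul0r.
by move: (\prod_i _) => p /eqP p0; rewrite -signr_odd expr1 => H; case: p0; lra.
Qed.

(** * The connecting homomorphism: image and vanishing *)

Lemma iota_Pic_tors2 (G : {group W}) (x : mod2_invariants G) :
  iota_Pic x *+ 2 = 0.
Proof.
rewrite -raddfMn; suff -> : x *+ 2 = 0 by rewrite raddf0.
apply: val_inj; rewrite (raddfMn val) /= -[invariant_val x]bar_repr.
rewrite -(raddfMn bar) -(raddf0 bar); apply/bar_eqP; rewrite subr0.
by apply/two_frakPP; exists (repr (invariant_val x)).
Qed.

(** If 2 f is the coboundary of m, then m is invariant modulo [2 frakP], and f is the half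
    coboundary defining [iota_Pic] of its class. *)
Lemma iota_Pic_surj (G : {group W}) (alpha : H1 G) :
  alpha *+ 2 = 0 -> exists x : mod2_invariants G, alpha = iota_Pic x.
Proof.
have [f ->] : exists f, alpha = H1_class f.
  by exists (repr alpha); rewrite /H1_class reprK.
rewrite -(raddfMn (@H1_class G)) -(raddf0 (@H1_class G)) => /eqP.
rewrite -Quotient.idealrBE subr0 => /asboolP[m fm].
have fE g : f g *+ 2 = W_act (sgval g) m - m.
  by rewrite -fm [cocycle_val (f *+ 2)](raddfMn val) ffunMnE.
have m_inv : bar m \in is_invariant G.
  apply/'forall_in_eqP=> g Gg; rewrite W_act_mod2_bar; apply/bar_eqP.
  by apply/two_frakPP; exists (f (subg G g)); rewrite fE subgK.
pose x := Mod2Invariant m_inv; have xm : invariant_val x = bar m by [].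
exists x; rewrite (iota_PicE xm); congr H1_class.
apply: val_inj; apply/ffunP=> g; rewrite ffunE; apply: val_inj => /=.
rewrite -[W_act_rat _ _ - _](raddfB val (W_act (sgval g) m)) -fE.
rewrite (raddfMn val) /=.
by rewrite -scaler_nat scalerA mulVf // scale1r.
Qed.

Lemma iota_Pic_eq0 (G : {group W}) (x : mod2_invariants G) (c : frakP) :
  invariant_val x = bar c -> {in G, forall g, W_act g c = c} -> iota_Pic x = 0.
Proof.
move=> xc cG; rewrite (iota_PicE xc) -(raddf0 (@H1_class G)); congr H1_class.
apply: val_inj; apply/ffunP=> g; rewrite !ffunE; apply: val_inj => /=.
have := congr1 val (cG _ (subgP g)) => /= ->.
by rewrite subrr scaler0.
Qed.

Lemma mem_gen_zmod (V : zmodType) (X : set V) v : X v -> v \in gen_zmod X.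
Proof. by move=> Xv; rewrite inE => A [_ sXA]; apply: sXA. Qed.

(** * Generation by classes of types I and II *)

Section Generation.

Variable G : {group W}.

Let generated := gen_zmod (type_I G `|` type_II G)%classic.

Let generated0 : 0 \in generated.
Proof. by have [] := gen_zmod_closed (type_I G `|` type_II G)%classic. Qed.

Let generatedD x y : x \in generated -> y \in generated -> x + y \in generated.
Proof.
have [g0 gB] := gen_zmod_closed (type_I G `|` type_II G)%classic => gx gy.
by rewrite -[y]opprK -[- y]sub0r; apply: (gB) => //; apply: gB.
Qed.

Lemma type_I_generated i (x : mod2_invariants G) :
  {in G, forall g, W_perm g i = i} -> invariant_val x = bar (e i) ->
  iota_Pic x \in generated.
Proof.
(* Classes of type I are nonzero by definition, so zero is treated apart. *)
move=> Gi xi; have [->//|nz] := eqVneq (iota_Pic x) 0.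
apply: mem_gen_zmod; left; split=> //.
  by rewrite inE; apply: iota_Pic_tors2.
exists i, x; split=> //; apply/setP=> j; rewrite inE; apply/imsetP/eqP.
  by case=> _ /imsetP[g Gg ->] ->; apply: Gi.
by move=> ->; exists (W_perm 1%g); rewrite ?imset_f //=; rewrite /aperm Gi.
Qed.

(** A stable pair need not be an orbit: if G fixes i, it fixes j too, and the class is a sum of two
    classes from [type_I_generated]. Otherwise some g sends i to j, and the pair is an orbit. *)
Lemma type_II_generated i j (x : mod2_invariants G) :
  i != j -> {in G, forall g, W_perm g @: [set i; j]%SET = [set i; j]%SET} ->
  invariant_val x = bar (e i + e j) -> iota_Pic x \in generated.
Proof.
move=> ij Gij xij; have [->//|nz] := eqVneq (iota_Pic x) 0.
have Wij g k : g \in G -> k \in [set i; j]%SET -> W_perm g k \in [set i; j]%SET.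
  by move=> Gg kij; rewrite -(Gij g Gg) imset_f.
have [Gi|] := boolP [forall g in G, W_perm g i == i].
  have {}Gi := 'forall_in_eqP Gi.
  have Gj : {in G, forall g, W_perm g j = j}.
    move=> g Gg; have := Wij g j Gg; rewrite !inE eqxx orbT => /(_ isT).
    by rewrite -{1}(Gi g Gg) (inj_eq perm_inj) eq_sym (negPf ij) => /eqP.
  have orb k : {in G, forall g, W_perm g k = k} -> bar (e k) \in is_invariant G.
    by move=> Gk; apply/'forall_in_eqP=> g Gg; rewrite W_act_mod2_e Gk.
  have -> : x = Mod2Invariant (orb i Gi) + Mod2Invariant (orb j Gj).
    by apply: val_inj; rewrite (raddfD val) /= xij (raddfD bar).
  rewrite raddfD; apply: generatedD.
    exact: (type_I_generated Gi).
  exact: (type_I_generated Gj).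
case/forall_inPn=> g Gg gi.
have gij : W_perm g i = j.
  by have := Wij g i Gg; rewrite !inE eqxx (negPf gi) => /(_ isT)/eqP.
apply: mem_gen_zmod; right; split=> //.
  by rewrite inE; apply: iota_Pic_tors2.
exists i, j, x; split=> //; apply/setP=> k; apply/imsetP/idP.
  by case=> _ /imsetP[h Gh ->] ->; apply: Wij; rewrite // !inE eqxx.
rewrite !inE => /orP[] /eqP->.
  by exists (W_perm 1%g); rewrite ?imset_f //= /aperm perm1.
by exists (W_perm g); rewrite ?imset_f.
Qed.

Lemma iota_Pic_e_sum_generated (A : {set 'I_5}) (x : mod2_invariants G) :
  (#|A| <= 2)%N -> invariant_val x = bar (e_sum A) -> iota_Pic x \in generated.
Proof.
move=> cA xA.
(* By invariance of x, A and its image have the same class; they also have the same cardinality. *)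
have GA : {in G, forall g, W_perm g @: A = A}.
  move=> g Gg; apply: bar_e_sum_inj.
    by rewrite card_imset //; apply: perm_inj.
  rewrite -W_act_mod2_e_sum -xA.
  exact: ('forall_in_eqP (valP x)).
case: (ltngtP #|A| 1) cA => [|cA2 cA|/eqP/cards1P[i AE] _].
- rewrite ltnS leqn0 cards_eq0 => /eqP A0 _.
  suff -> : x = 0 by rewrite raddf0.
  by apply: val_inj; rewrite /= xA A0 /e_sum big_set0 raddf0.
- have /cards2P[i [j [ij AE]]] : #|A| == 2 by rewrite eqn_leq cA.
  apply: (@type_II_generated i j) => //; first by rewrite -AE.
  by rewrite xA AE /e_sum big_setU1 ?inE //= big_set1.
- apply: (@type_I_generated i); last by rewrite xA AE /e_sum big_set1.
  by move=> g Gg; apply/set1P; rewrite -AE -(GA g Gg) imset_f // AE set11.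
Qed.

Lemma iota_Pic_generated (x : mod2_invariants G) : iota_Pic x \in generated.
Proof.
have xE := esym (bar_repr (invariant_val x)).
have [[A cA mA]|[u uE mu]] := bar_cases (repr (invariant_val x)).
  by apply: (iota_Pic_e_sum_generated cA); rewrite -mA.
rewrite (@iota_Pic_eq0 _ _ u) //; first by rewrite -mu.
move=> g Gg; apply: W_act_fix_half_signs => //.
by rewrite -W_act_mod2_bar -mu -xE; apply: ('forall_in_eqP (valP x)).
Qed.

End Generation.

Theorem lemma3p15 (G : {group W}) :
  H1_tors2 G = gen_zmod (type_I G `|` type_II G)%classic.
Proof.
apply/seteqP; split=> alpha.
  case/iota_Pic_surj=> x ->; rewrite -in_setE; exact: iota_Pic_generated.
(* Conversely, the 2-torsion is a subgroup containing the generators, so minimality applies. *)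
apply; split; last by move=> beta [] [] /[!inE].
split=> [|x y]; rewrite -!topredE /= !inE /H1_tors2 /= ?mul0rn //.
by move=> x2 y2; rewrite mulrnBl x2 y2 subr0.
Qed.
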